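(* Let $\mathcal{S}=\{\Sigma_0,\ldots,\Sigma_{S-1}\}\subset\mathbb{C}^{L\times L}$ be a linearly independent set (over $\mathbb{R}$) of $S$ Hermitian Toeplitz matrices, and let $\mathcal{A}$ be the set of positive semidefinite matrices. Then $\dim_{\mathbb{R}}[\mathcal{A}\cap\mathrm{span}_{\mathbb{R}}\,\mathcal{S}]=S$ if at least one of the following conditions holds: 1. $\Sigma\geq 0$ for all $\Sigma\in\mathcal{S}$; 2. there exists $\Sigma\in\mathrm{span}_{\mathbb{R}}\,\mathcal{S}$ such that $\Sigma>0$.
   Context: For a set of matrices $\mathcal{B}$ (not necessarily a subspace), $\dim_{\mathbb{R}}\mathcal{B}$ denotes the smallest natural number $n$ such that there is a set $\mathcal{D}$ of $n$ matrices with $\mathcal{B}\subset\mathrm{span}_{\mathbb{R}}\,\mathcal{D}$, where $\mathrm{span}_{\mathbb{R}}$ denotes the set of linear combinations with real coefficients. $\Sigma\geq 0$ and $\Sigma>0$ mean that the Hermitian matrix $\Sigma$ is positive semidefinite and positive definite, respectively. A Hermitian Toeplitz matrix is a matrix that is Hermitian and constant along each diagonal. *)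

(* Defs.v *)
From mathcomp Require Import all_boot all_order all_algebra finmap.
From mathcomp Require Import boolp classical_sets reals complex.
Set Implicit Arguments.
Unset Strict Implicit.
Unset Printing Implicit Defensive.
Import Order.TTheory GRing.Theory Num.Theory.
Local Open Scope ring_scope.
Local Open Scope classical_set_scope.
Local Open Scope complex_scope.
Local Open Scope sesquilinear_scope.

Section Defs.
Variables (R : realType) (L : nat).
Implicit Types (A M : 'M[R[i]]_L) (D : {fset 'M[R[i]]_L}).
Implicit Types (B : set 'M[R[i]]_L).

Definition toeplitzmx A : Prop :=
  forall i j k l : 'I_L, i%:Z - j%:Z = k%:Z - l%:Z -> A i j = A k l.

(* In the order of R[i], 0 <= z and 0 < z entail that z is real. *)
Definition psdmx A : Prop :=
  A \is hermsymmx /\ forall x : 'cV[R[i]]_L, 0 <= (x ^t* *m A *m x) 0 0.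

Definition pdmx A : Prop :=
  A \is hermsymmx /\
  forall x : 'cV[R[i]]_L, x != 0 -> 0 < (x ^t* *m A *m x) 0 0.

(* 'M[R[i]]_L carries a module structure over R[i] only, so real linear
   combinations are written with the embedding %:C of R into R[i]; only the
   values of c on the finite set D matter. *)
Definition real_comb D (c : 'M[R[i]]_L -> R) : 'M[R[i]]_L :=
  \sum_(M <- D) (c M)%:C *: M.

Definition real_span D : set 'M[R[i]]_L :=
  [set A | exists c : 'M[R[i]]_L -> R, A = real_comb D c].

Definition real_free D : Prop :=
  forall c : 'M[R[i]]_L -> R,
    real_comb D c = 0 -> forall M, M \in D -> c M = 0.

Definition spanned_by_card B (n : nat) : Prop :=
  exists D, #|` D| = n /\ B `<=` real_span D.

Lemma real_spanD D A M : real_span D A -> real_span D M -> real_span D (A + M).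
Proof.
move=> [c ->] [d ->]; exists (fun N => c N + d N).
rewrite /real_comb -big_split; apply: eq_bigr => N _ /=.
by rewrite rmorphD scalerDl.
Qed.

Lemma real_spanZ D (a : R) M : M \in D -> real_span D (a%:C *: M).
Proof.
move=> MD; exists (fun N => if N == M then a else 0).
rewrite /real_comb (big_fsetD1 M) //= eqxx big1_fset ?addr0 // => N.
by rewrite !inE => /andP[/negPf -> _] _; rewrite scale0r.
Qed.

Lemma real_span_sum D (I : finType) (F : I -> 'M[R[i]]_L) :
  (forall i, real_span D (F i)) -> real_span D (\sum_i F i).
Proof.
move=> DF; apply: big_ind => //; last exact: real_spanD.
by exists (fun=> 0); rewrite /real_comb big1 // => N _; rewrite scale0r.
Qed.

Lemma ex_spanned_by_card B : exists n, `[< spanned_by_card B n >].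
Proof.
pose s : seq 'M[R[i]]_L :=
  [seq delta_mx p.1 p.2 | p : 'I_L * 'I_L] ++
  [seq 'i *: delta_mx p.1 p.2 | p : 'I_L * 'I_L].
pose D : {fset 'M[R[i]]_L} := [fset M in s]%fset.
exists #|` D|; apply/asboolP; exists D; split=> // A _.
rewrite (matrix_sum_delta A).
apply: real_span_sum => i; apply: real_span_sum => j.
case: (A i j) => a b.
have -> : a +i* b = a%:C + b%:C * 'i :> R[i] by simpc.
rewrite scalerDl -scalerA; apply: real_spanD; apply: real_spanZ.
  rewrite in_fset /= mem_cat; apply/orP; left.
  by apply/mapP; exists (i, j); rewrite ?mem_enum.
rewrite in_fset /= mem_cat; apply/orP; right.
by apply/mapP; exists (i, j); rewrite ?mem_enum.
Qed.

Definition real_dim B : nat := ex_minn (ex_spanned_by_card B).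

End Defs.

(* Main.v *)
(* Every member Sigma of S is a real combination of positive semidefinite
   members of the span of S: Sigma itself in the first case, and
   Sigma = (t P + Sigma) - t P with P positive definite and t large in the
   second.  So a set whose real span contains these positive semidefinite
   matrices spans all of S, hence has at least as many elements as S, by
   freeness. *)
Require Import Defs.
From mathcomp Require Import all_boot all_order all_algebra finmap.
From mathcomp Require Import boolp classical_sets reals complex.
Set Implicit Arguments.
Unset Strict Implicit.
Unset Printing Implicit Defensive.
Import Order.TTheory GRing.Theory Num.Theory.
Local Open Scope ring_scope.
Local Open Scope classical_set_scope.
Local Open Scope complex_scope.
Local Open Scope sesquilinear_scope.

Lemma trmxC_mul (C : numClosedFieldType) (m n p : nat)
    (A : 'M[C]_(m, n)) (B : 'M[C]_(n, p)) :
  (A *m B)^t* = B^t* *m A^t*.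
Proof. by rewrite trmx_mul map_mxM. Qed.

Lemma hermsymmxP (C : numClosedFieldType) (n : nat) (A : 'M[C]_n) :
  reflect (A^t* = A) (A \is hermsymmx).
Proof.
rewrite is_hermitianmxE expr0 scale1r eq_sym; exact: eqP.
Qed.

Lemma hermsymmxD (C : numClosedFieldType) (n : nat) (A B : 'M[C]_n) :
  A \is hermsymmx -> B \is hermsymmx -> A + B \is hermsymmx.
Proof.
move=> /hermsymmxP hA /hermsymmxP hB; apply/hermsymmxP.
by rewrite linearD map_mxD hA hB.
Qed.

Lemma hermsymmxZ (C : numClosedFieldType) (n : nat) (t : C) (A : 'M[C]_n) :
  t \is Num.real -> A \is hermsymmx -> t *: A \is hermsymmx.
Proof.
move=> /CrealP ht /hermsymmxP hA; apply/hermsymmxP.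
by rewrite linearZ map_mxZ hA; congr (_ *: _); exact: ht.
Qed.

Lemma hermsymmx_form_real (C : numClosedFieldType) (n : nat) (A : 'M[C]_n)
    (x : 'cV[C]_n) :
  A \is hermsymmx -> (x ^t* *m A *m x) 0 0 \is Num.real.
Proof.
move=> /hermsymmxP hA; apply/CrealP.
have: (x ^t* *m A *m x)^t* = x ^t* *m A *m x.
  by rewrite !trmxC_mul hA trmxCK mulmxA.
by move=> /matrixP/(_ 0 0); rewrite !mxE.
Qed.

(** A crude operator norm bound: each [|y i 0| * |y j 0|] is at most the larger of the two squares,
    hence at most the whole sum of squares. *)
Lemma form_norm_le (C : numClosedFieldType) (n : nat) (B : 'M[C]_n)
    (y : 'cV[C]_n) :
  `|(y ^t* *m B *m y) 0 0| <=
  (\sum_i \sum_j `|B i j|) * (\sum_k `|y k 0| ^+ 2).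
Proof.
have sum_ge i : `|y i 0| ^+ 2 <= \sum_k `|y k 0| ^+ 2.
  by rewrite (bigD1 i) //= lerDl sumr_ge0 // => k _; rewrite exprn_ge0.
have prod_le i j : `|y i 0| * `|y j 0| <= \sum_k `|y k 0| ^+ 2.
  have [le_ij|le_ji] := real_leP (normr_real (y i 0)) (normr_real (y j 0)).
    by apply: le_trans (sum_ge j); rewrite expr2 ler_wpM2r.
  by apply: le_trans (sum_ge i); rewrite expr2 ler_wpM2l // ltW.
rewrite mxE exchange_big mulr_suml; apply: le_trans (ler_norm_sum _ _ _) _.
apply: ler_sum => j _; rewrite mxE mulr_suml mulr_suml.
apply: le_trans (ler_norm_sum _ _ _) _; apply: ler_sum => i _.
rewrite !mxE !normrM norm_conjC mulrAC mulrC.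
exact: ler_wpM2l.
Qed.

(** The spectral theorem gives unitary coordinates [y = U *m x] in which the form of [P] is the sum
    of [d 0 i * |y i 0| ^+ 2] with every [d 0 i] positive, while the form of [A] is bounded in
    modulus by a constant [c] times the sum of the [|y i 0| ^+ 2]. Any [t] with [c <= t * d 0 i] for
    all [i] then works. *)
Lemma pd_form_dominates (C : numClosedFieldType) (n : nat) (P A : 'M[C]_n) :
  P \is hermsymmx ->
  (forall x : 'cV[C]_n, x != 0 -> 0 < (x ^t* *m P *m x) 0 0) ->
  A \is hermsymmx ->
  exists2 t : C, 0 <= t &
    forall x : 'cV[C]_n, 0 <= (x ^t* *m (t *: P + A) *m x) 0 0.
Proof.
move=> hP P_gt0 hA.
set U := spectralmx P; set d := spectral_diag P.
have Uu : U \is unitarymx by exact: spectral_unitarymx.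
have UUt : U *m U^t* = 1%:M by exact/unitarymxP.
have UtU : U^t* *m U = 1%:M by exact: mulmx1C.
have PE : P = U^t* *m diag_mx d *m U.
  by rewrite -invmx_unitary //; apply/orthomx_spectralP/hermitian_normalmx.
have formP x : (x ^t* *m P *m x) 0 0 = \sum_i d 0 i * `|(U *m x) i 0| ^+ 2.
  have -> : x ^t* *m P *m x = (U *m x)^t* *m diag_mx d *m (U *m x).
    by rewrite {1}PE trmxC_mul !mulmxA.
  rewrite mxE; apply: eq_bigr => i _; move: (U *m x) => y.
  by rewrite mul_mx_diag !mxE normCK mulrAC mulrC [X in _ * X]mulrC.
have d_gt0 i : 0 < d 0 i.
  (* An eigenvector of [P] for [d 0 i], at which the form of [P] takes exactly this value. *)
  pose x : 'cV[C]_n := U^t* *m delta_mx i 0.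
  have Ux : U *m x = delta_mx i 0 by rewrite mulmxA UUt mul1mx.
  have x_neq0 : x != 0.
    apply/eqP => x0; move: Ux; rewrite x0 mulmx0 => /matrixP/(_ i 0)/eqP.
    by rewrite !mxE !eqxx eq_sym oner_eq0.
  have := P_gt0 x x_neq0; rewrite formP Ux (bigD1 i) //= big1 ?addr0.
    by rewrite mxE !eqxx normr1 expr1n mulr1.
  by move=> k /negPf ki; rewrite mxE ki normr0 expr0n mulr0.
pose B := U *m A *m U^t*; pose c : C := \sum_i \sum_j `|B i j|.
have formA x : (x ^t* *m A *m x) 0 0 = ((U *m x)^t* *m B *m (U *m x)) 0 0.
  have -> : A = U^t* *m B *m U.
    by rewrite !mulmxA UtU mul1mx -mulmxA UtU mulmx1.
  by rewrite trmxC_mul !mulmxA.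
have c_ge0 : 0 <= c by rewrite !sumr_ge0 // => i _; rewrite sumr_ge0.
have cd_ge0 i : 0 <= c / d 0 i by rewrite divr_ge0 // ltW.
(* The terms are nonnegative, so their sum bounds each [c / d 0 i] and serves in place of a
   maximum. *)
exists (\sum_i c / d 0 i) => [|x]; first exact: sumr_ge0.
rewrite mulmxDr mulmxDl mxE -scalemxAr -scalemxAl [X in X + _]mxE.
(* The form of [A] is real, so it suffices that [t] times the form of [P] bounds its absolute
   value. *)
apply: le_trans (_ : 0 <= `|(x ^t* *m A *m x) 0 0| + (x ^t* *m A *m x) 0 0) _.
  by rewrite -lerBlDr sub0r -normrN real_ler_norm // rpredN hermsymmx_form_real.
rewrite lerD2r formP {1}formA; apply: le_trans (form_norm_le _ _) _.
rewrite -/c !mulr_sumr; apply: ler_sum => i _.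
rewrite [leRHS]mulrA ler_wpM2r ?exprn_ge0 // -ler_pdivrMr //.
by rewrite (bigD1 i) //= lerDl sumr_ge0.
Qed.

Section RealSpan.
Variables (R : realType) (L : nat).
Implicit Types (D S : {fset 'M[R[i]]_L}) (A M : 'M[R[i]]_L).

Lemma real_span_scale D (a : R) A : real_span D A -> real_span D (a%:C *: A).
Proof.
move=> [c ->]; exists (fun M => a * c M).
rewrite /real_comb scaler_sumr; apply: eq_bigr => M _.
by rewrite scalerA rmorphM.
Qed.

Lemma real_span_mem D M : M \in D -> real_span D M.
Proof. by move=> /(real_spanZ 1); rewrite rmorph1 scale1r. Qed.

(** Let row [i] of [Z] hold coefficients over [D] of the [i]-th member of [S]. A left kernel vector
    of [Z] is a real linear relation on [S], hence zero; so [Z] has full row rank, which is at most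
    its number of columns. *)
Lemma real_free_card_le S D :
  real_free S -> (forall M, M \in S -> real_span D M) -> (#|` S| <= #|` D|)%N.
Proof.
move=> S_free SD.
pose s := in_tuple S; pose t := in_tuple D.
have /choice[c cE] (i : 'I_#|` S|) : exists c, tnth s i = real_comb D c.
  by apply: SD; exact: mem_tnth.
pose Z : 'M[R]_(#|` S|, #|` D|) := \matrix_(i, j) c i (tnth t j).
suff /eqP <- : row_free Z by exact: rank_leq_col.
rewrite -kermx_eq0; apply/rowV0P => v /sub_kermxP vZ0.
(* Turns the vector [v] into a coefficient function on matrices; as [S] has no repetition, the sum
   has a single term at each member of [S]. *)
pose a M := \sum_(i | tnth s i == M) v 0 i.
have aE i : a (tnth s i) = v 0 i.
  rewrite /a (big_pred1 i) // => j /=.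
  apply/eqP/eqP => [|-> //]; apply/tuple_uniqP; exact: fset_uniq.
have a0 : real_comb S a = 0.
  rewrite /real_comb big_tnth.
  under eq_bigr => i _.
    rewrite aE cE /real_comb big_tnth scaler_sumr.
    under eq_bigr do rewrite scalerA -rmorphM.
    over.
  (* Collected this way, the coefficient of the [j]-th member of [D] is entry [j] of [v *m Z]. *)
  rewrite exchange_big big1 // => j _.
  rewrite -scaler_suml -rmorph_sum.
  have /matrixP/(_ 0 j) := vZ0; rewrite !mxE.
  under eq_bigr do rewrite mxE.
  by move=> ->; rewrite rmorph0 scale0r.
apply/rowP => i; rewrite mxE -aE; apply: (S_free _ a0); exact: mem_tnth.
Qed.

Lemma real_dim_eq (B : set 'M[R[i]]_L) (n : nat) :
  spanned_by_card B n ->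
  (forall m, spanned_by_card B m -> (n <= m)%N) ->
  real_dim B = n.
Proof.
move=> Bn n_min; rewrite /real_dim; case: ex_minnP => m /asboolP Bm m_min.
by apply/eqP; rewrite eqn_leq n_min // m_min //; apply/asboolP.
Qed.

Lemma pdmx_psdmx A : pdmx A -> psdmx A.
Proof.
move=> [hA A_gt0]; split=> // x; have [->|/A_gt0/ltW //] := eqVneq x 0.
by rewrite mulmx0 mxE.
Qed.

Lemma pdmx_dominates (P A : 'M[R[i]]_L) :
  pdmx P -> A \is hermsymmx -> exists t : R, psdmx (t%:C *: P + A).
Proof.
move=> [hP P_gt0] hA.
have [t t_ge0 psd] := pd_form_dominates hP P_gt0 hA.
have tR : t \is Num.real by exact: ger0_real.
(* The factor [t] is obtained in [R[i]]; being nonnegative there, it equals its real part. *)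
exists (complex.Re t); rewrite RRe_real //; split=> //.
by rewrite hermsymmxD // hermsymmxZ.
Qed.

End RealSpan.

Theorem lemma2 (R : realType) (L : nat) (S : {fset 'M[R[i]]_L})
  (S_free : real_free S)
  (S_herm : forall Sigma, Sigma \in S -> Sigma \is hermsymmx)
  (S_toep : forall Sigma, Sigma \in S -> toeplitzmx Sigma) :
  (forall Sigma, Sigma \in S -> psdmx Sigma) \/
  (exists Sigma, real_span S Sigma /\ pdmx Sigma) ->
  real_dim ([set A | psdmx A] `&` real_span S) = #|` S|.
Proof.
move=> S_cond; apply: real_dim_eq => [|n [D [<- BD]]].
  (* [S] itself gives the upper bound; what follows is the lower bound, for an arbitrary spanning
     [D]. *)
  by exists S; split=> // A [].
apply: real_free_card_le => // M MS.
case: S_cond => [S_psd|[P [SP P_pd]]].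
  by apply: BD; split; [exact: S_psd | exact: real_span_mem].
have [t tPM_psd] := pdmx_dominates P_pd (S_herm M MS).
have DP : real_span D P by apply: BD; split; first exact: pdmx_psdmx.
have DtPM : real_span D (t%:C *: P + M).
  apply: BD; split=> //; apply: real_spanD (real_span_mem MS).
  exact: real_span_scale.
have -> : M = (- t)%:C *: P + (t%:C *: P + M).
  by rewrite addrA -scalerDl -rmorphD addNr rmorph0 scale0r add0r.
exact/real_spanD/DtPM/real_span_scale.
Qed.
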